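(* Let $\phi_i^n$ ($i=0,\dots,N$) evolve according to the local Lax–Friedrichs scheme on the mapped grid with time step $\Delta t>0$, $$\phi_i^{n+1}=\phi_i^n-\Delta t\,\hat{\tilde H}_i(\phi_{\xi,i}^{-},\phi_{\xi,i}^{+}),\qquad i=0,\dots,N,$$ $$\hat{\tilde H}_i(u^-,u^+)=\tilde H_i\Big(\frac{u^-+u^+}{2}\Big)-\alpha_{\tilde H_i}(u^-,u^+)\frac{u^+-u^-}{2}.$$ Then the scheme is conservative in terms of $\phi_x$. That is, the cell quantities $$\Phi_i^n:=\frac{\phi_{i+1}^n-\phi_i^n}{\Delta x_i}\qquad (i=0,\dots,N-1)$$ satisfy an update of the conservative form $$\frac{\Phi_i^{n+1}-\Phi_i^n}{\Delta t}=-\frac{1}{\Delta x_i}\Big[\hat H(\phi_{x,i+1}^{-},\phi_{x,i+1}^{+})-\hat H(\phi_{x,i}^{-},\phi_{x,i}^{+})\Big],\qquad i=0,\dots,N-1,$$ where $\hat H:\mathbb{R}^2\to\mathbb{R}$ is a monotone numerical flux (the same function for all $i$ and all time steps, nondecreasing in its first argument and nonincreasing in its second) which is consistent with $H$, i.e. $\hat H(u,u)=H(u)$ for all $u$. In other words, it is a conservative approximation to the hyperbolic conservation law $\Phi_t+H(\Phi)_x=0$.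
   Context: Consider the one-dimensional Hamilton–Jacobi equation $\phi_t+H(\phi_x)=0$ on $[a,b]$, where $H:\mathbb{R}\to\mathbb{R}$ is Lipschitz continuous and continuously differentiable. The interval is partitioned by a possibly nonuniform grid $a=x_0<x_1<\dots<x_N=b$, with $\Delta x_i=x_{i+1}-x_i$. Let $\xi_i=i\Delta\xi$, $\Delta\xi=1/N$, be the uniform grid on $[0,1]$, and let $x=x(\xi):[0,1]\to[a,b]$ be a one-to-one differentiable coordinate transformation with $x(0)=a$, $x(1)=b$, $x(\xi_i)=x_i$ and Jacobian $J=x_\xi>0$. Write $J_i=J(\xi_i)$, so that $\xi_x=1/J_i$ at grid point $i$. Under this transformation the equation becomes $\phi_t+\tilde H(\phi_\xi)=0$ on $[0,1]$ with $\tilde H(\phi_\xi):=H(\xi_x\phi_\xi)$; at grid point $i$ this is the function $\tilde H_i(u)=H(u/J_i)$. The values $\phi_{\xi,i}^{-}$ and $\phi_{\xi,i}^{+}$ are left-biased and right-biased numerical approximations to $\phi_\xi$ at $\xi_i$ (computed from the numerical solution at time level $n$). The corresponding approximations to $\phi_x$ at $x_i$ are the values $\phi_{x,i}^{\pm}$ defined by $\phi_{\xi,i}^{\pm}=J_i\,\phi_{x,i}^{\pm}$. The viscosity coefficient is $\alpha_{\tilde H_i}(u^-,u^+)=\max\{|\tilde H_i'(u)|: u\in[\min(u^-,u^+),\max(u^-,u^+)]\}$. The scheme is the forward-Euler time discretization of the semi-discrete scheme $\frac{d}{dt}\phi_i(t)+\hat{\tilde H}_i(\phi_{\xi,i}^-,\phi_{\xi,i}^+)=0$.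 *)

(* Defs.v *)
From HB Require Import structures.
From mathcomp Require Import all_boot all_order all_algebra.
From mathcomp Require Import all_classical all_reals all_analysis.
Import Order.TTheory GRing.Theory Num.Theory.
Import numFieldNormedType.Exports.

Set Implicit Arguments.
Unset Strict Implicit.
Unset Printing Implicit Defensive.

Local Open Scope classical_set_scope.
Local Open Scope ring_scope.

(* Values at the N+1 grid points 0, ..., N. *)
Definition gridfun (R : realType) (N : nat) : Type := 'I_N.+1 -> R.

(* A cell i : 'I_N lies between the grid points i and i + 1. *)
Definition lpt (N : nat) (i : 'I_N) : 'I_N.+1 := widen_ord (leqnSn N) i.
Definition rpt (N : nat) (i : 'I_N) : 'I_N.+1 := lift ord0 i.

Definition xi (R : realType) (N : nat) : gridfun R N :=
  fun i => (i : nat)%:R / N%:R.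
Arguments xi R N i : clear implicits.

Definition spacing (R : realType) (N : nat) (x : gridfun R N) (i : 'I_N) : R :=
  x (rpt i) - x (lpt i).

(* Derivative relative to a set D, hence one-sided at an endpoint of D:
   x^' is the filter of punctured neighbourhoods of x. *)
Definition has_derivative_within (R : realType) (D : set R) (f : R -> R)
    (x df : R) : Prop :=
  (f y - f x) / (y - x) @[y --> within D x^'] --> df.

Definition continuously_differentiable (R : realType) (f : R -> R) : Prop :=
  (forall u, derivable f u 1) /\ continuous (f^`())%classic.

(* The maximum of A; it is 0 by convention when A has no greatest element. *)
Definition set_max (R : realType) (A : set R) : R := xget 0 (A `&` ubound A).

(* For F := H, v := J_i this is u |-> H(xi_x u), with xi_x = 1 / J_i. *)
Definition transformed (R : realType) (F : R -> R) (v : R) : R -> R :=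
  fun u => F (u / v).

Definition viscosity (R : realType) (F : R -> R) (um up : R) : R :=
  set_max [set `|(F^`())%classic u| | u in `[Num.min um up, Num.max um up]].

Definition local_lax_friedrichs (R : realType) (F : R -> R) (um up : R) : R :=
  F ((um + up) / 2) - viscosity F um up * ((up - um) / 2).

Definition monotone_flux (R : realType) (F : R -> R -> R) : Prop :=
  (forall um um' up, um <= um' -> F um up <= F um' up) /\
  (forall um up up', up <= up' -> F um up' <= F um up).

Definition consistent_flux (R : realType) (F : R -> R -> R) (H : R -> R) : Prop :=
  forall u, F u u = H u.

Definition cell_slope (R : realType) (N : nat) (x phi : gridfun R N) (i : 'I_N) : R :=
  (phi (rpt i) - phi (lpt i)) / spacing x i.

(* Main.v *)
(* Divide the mapped flux out: at a grid point with Jacobian J_i, the chain rule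
   gives alpha_{H~_i}(J_i u, J_i v) = alpha_H(u, v) / J_i, so the mapped flux is
   the local Lax-Friedrichs flux of H itself at (phi_x^-, phi_x^+). It remains to
   see that this flux is monotone: by the mean value theorem the variation of
   H((u + v) / 2) in one argument is bounded by that of alpha_H(u, v) (u - v) / 2. *)
Require Import Defs.
From HB Require Import structures.
From mathcomp Require Import all_boot all_order all_algebra.
From mathcomp Require Import all_classical all_reals all_analysis.
From mathcomp Require Import ring lra.
Import Order.TTheory GRing.Theory Num.Theory.
Import numFieldNormedType.Exports.

Local Open Scope classical_set_scope.
Local Open Scope ring_scope.

Lemma set_max_unique (R : realType) (A : set R) (m : R) :
  A m -> ubound A m -> set_max A = m.
Proof.
move=> Am mub; apply: xget_unique => // y [Ay yub].
by apply/eqP; rewrite eq_le mub // yub.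
Qed.

Lemma viscosityC (R : realType) (F : R -> R) (u v : R) :
  viscosity F u v = viscosity F v u.
Proof. by rewrite /viscosity minC maxC. Qed.

Section ContinuouslyDifferentiable.
Variables (R : realType) (F : R -> R).
Hypothesis F_C1 : continuously_differentiable F.

(** By continuity of F' and compactness of the interval the maximum is attained, so the default
    value 0 of [set_max] never intervenes. *)
Lemma viscosity_max (u v : R) :
  (exists2 c, c \in `[Num.min u v, Num.max u v] &
    viscosity F u v = `|(F^`())%classic c|) /\
  (forall c, c \in `[Num.min u v, Num.max u v] ->
    `|(F^`())%classic c| <= viscosity F u v).
Proof.
have le_minmax : Num.min u v <= Num.max u v by rewrite ge_min !le_max lexx.
have F'_cont : continuous (fun t => `|(F^`())%classic t|).
  by move=> t; apply: cvg_norm; exact: F_C1.2.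
have [c cI c_max] := EVT_max le_minmax (continuous_subspaceT F'_cont).
have -> : viscosity F u v = `|(F^`())%classic c|.
  by apply: set_max_unique => [|_ [t tI <-]]; [exists c | exact: c_max].
by split=> //; exists c.
Qed.

Lemma viscosity_le (u v u' v' : R) :
  Num.min u' v' <= Num.min u v -> Num.max u v <= Num.max u' v' ->
  viscosity F u v <= viscosity F u' v'.
Proof.
move=> le_min' le_max'; have [[c cI ->] _] := viscosity_max u v.
apply: (viscosity_max u' v').2; move: cI; rewrite !in_itv /= => /andP[cl cr].
by rewrite (le_trans le_min' cl) (le_trans cr le_max').
Qed.

Lemma viscosity_lipschitz (u v x y : R) :
  Num.min u v <= x -> x <= y -> y <= Num.max u v ->
  `|F y - F x| <= viscosity F u v * (y - x).
Proof.
move=> ux xy yv.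
have F_der t : t \in `]x, y[ -> is_derive t 1 F ((F^`())%classic t).
  by move=> _; rewrite derive1E; apply/derivableP; apply: F_C1.1.
have F_cont : {within `[x, y], continuous F}.
  by apply: continuous_subspaceT => t; apply/differentiable_continuous/derivable1_diffP/F_C1.1.
have [c + ->] := MVT_segment xy F_der F_cont.
rewrite in_itv /= => /andP[xc cy].
rewrite normrM (ger0_norm (_ : 0 <= y - x)) ?subr_ge0 //.
rewrite ler_wpM2r ?subr_ge0 //; apply: (viscosity_max u v).2.
by rewrite in_itv /= (le_trans ux xc) (le_trans cy yv).
Qed.

(** The viscous term dominates the central term of the flux: the two signs of the absolute value
    give monotonicity in the two arguments. *)
Lemma midpoint_variation (x y z : R) : x <= y ->
  `|F ((y + z) / 2) - F ((x + z) / 2)| <=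
  (viscosity F y z * (y - z) - viscosity F x z * (x - z)) / 2.
Proof.
(* Both midpoints lie in [[z, b]] and differ by (b - a) / 2. Beyond the mean value bound, the
   right-hand side contains the nonnegative excess ([viscosity F b z] - [viscosity F a z]) (a - z) /
   2. *)
have right_of a b : z <= a -> a <= b ->
    `|F ((b + z) / 2) - F ((a + z) / 2)| <=
    (viscosity F b z * (b - z) - viscosity F a z * (a - z)) / 2.
  move=> za ab; have zb := le_trans za ab.
  have visc_le : viscosity F a z <= viscosity F b z.
    by apply: viscosity_le; rewrite ?(min_r za) ?(min_r zb) ?(max_l za) ?(max_l zb).
  have : `|F ((b + z) / 2) - F ((a + z) / 2)| <=
      viscosity F b z * ((b + z) / 2 - (a + z) / 2).
    by apply: viscosity_lipschitz; rewrite ?(min_r zb) ?(max_l zb); lra.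
  by nra.
(* Mirror image: now [[a, z]] is the larger interval, so its viscosity serves as the Lipschitz
   constant. *)
have left_of a b : b <= z -> a <= b ->
    `|F ((b + z) / 2) - F ((a + z) / 2)| <=
    (viscosity F b z * (b - z) - viscosity F a z * (a - z)) / 2.
  move=> bz ab; have az := le_trans ab bz.
  have visc_le : viscosity F b z <= viscosity F a z.
    by apply: viscosity_le; rewrite ?(min_l az) ?(min_l bz) ?(max_r az) ?(max_r bz).
  have : `|F ((b + z) / 2) - F ((a + z) / 2)| <=
      viscosity F a z * ((b + z) / 2 - (a + z) / 2).
    by apply: viscosity_lipschitz; rewrite ?(min_l az) ?(max_r az); lra.
  by nra.
move=> xy; have [zx|/ltW xz] := leP z x; first exact: right_of.
have [zy|/ltW yz] := leP z y; last exact: left_of.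
(* When z separates x and y, pass through z, where the viscous term vanishes. *)
have := right_of z y (lexx z) zy; have := left_of x z (lexx z) xz.
rewrite subrr !mulr0 => xz_le zy_le.
apply: le_trans (ler_distD (F ((z + z) / 2)) _ _) _.
by apply: le_trans (lerD zy_le xz_le) _; lra.
Qed.

Lemma local_lax_friedrichs_monotone : monotone_flux (local_lax_friedrichs F).
Proof.
split=> [u u' v uu'|u v v' vv']; rewrite /local_lax_friedrichs.
  by have := midpoint_variation _ _ v uu'; rewrite ler_norml => /andP[]; lra.
have := midpoint_variation _ _ u vv'.
(* Symmetry moves the fixed argument u into the second slot, as in the bound. *)
rewrite !(viscosityC _ F u) !(addrC u) ler_norml => /andP[_]; lra.
Qed.

Lemma transformed_derive1 (v u : R) :
  ((transformed F v)^`())%classic u = (F^`())%classic (u / v) / v.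
Proof.
have -> : transformed F v = F \o (v^-1 \*: (@id R)).
  by apply/funext => t; rewrite /transformed /= mulrC.
have [scale_der scale_val] : is_derive u 1 (v^-1 \*: (@id R)) (v^-1 *: 1).
  exact: is_deriveZ.
rewrite derive1_comp //; last exact: F_C1.1.
by rewrite (derive1E (v^-1 \*: _)) scale_val -[_ *: 1]/(_ * _) mulr1 [u / v]mulrC.
Qed.

Lemma viscosity_transformed (v um up : R) : 0 < v ->
  viscosity (transformed F v) (v * um) (v * up) = viscosity F um up / v.
Proof.
move=> v_gt0; have v_neq0 := lt0r_neq0 v_gt0.
have [[c cI ->] F'_le] := viscosity_max um up.
have norm_derive t :
    `|((transformed F v)^`())%classic t| = `|(F^`())%classic (t / v)| / v.
  by rewrite transformed_derive1 normrM (gtr0_norm (_ : 0 < v^-1)) ?invr_gt0.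
have v_ge0 := ltW v_gt0.
rewrite /viscosity -minr_pMr // -maxr_pMr //; apply: set_max_unique.
  (* Scaling by v > 0 carries one interval onto the other, hence a maximizer to a maximizer. *)
  exists (v * c); last by rewrite norm_derive mulrAC mulfV // mul1r.
  by move: cI; rewrite /= !in_itv /= !ler_pM2l.
move=> _ [t /= + <-]; rewrite norm_derive in_itv /= => /andP[lt tr].
rewrite ler_wpM2r ?invr_ge0 //; apply: F'_le.
by rewrite in_itv /= ler_pdivlMr // ler_pdivrMr // !(mulrC _ v) lt tr.
Qed.

End ContinuouslyDifferentiable.

Lemma local_lax_friedrichs_consistent (R : realType) (F : R -> R) :
  consistent_flux (local_lax_friedrichs F) F.
Proof.
move=> u; rewrite /local_lax_friedrichs subrr mul0r mulr0 subr0.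
by congr (F _); field.
Qed.

(** The factor 1 / v in the viscosity cancels the factor v in the jump. *)
Lemma local_lax_friedrichs_transformed (R : realType) (F : R -> R)
    (v um up : R) : continuously_differentiable F -> 0 < v ->
  local_lax_friedrichs (transformed F v) (v * um) (v * up) =
  local_lax_friedrichs F um up.
Proof.
move=> F_C1 v_gt0; have v_neq0 := lt0r_neq0 v_gt0.
rewrite /local_lax_friedrichs viscosity_transformed // /transformed.
by congr (F _ - _); field.
Qed.

Lemma xi_in01 (R : realType) (N : nat) (i : 'I_N.+1) : (0 < N)%N ->
  xi R N i \in `[0, 1].
Proof.
move=> N_gt0; rewrite /xi in_itv /= divr_ge0 ?ler0n //=.
by rewrite ler_pdivrMr ?ltr0n // mul1r ler_nat -ltnS.
Qed.

Theorem lemma3p1 (R : realType) (H : R -> R)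
  (H_lip : exists k : R, k.-lipschitz H)
  (H_C1 : continuously_differentiable H)
  (a b : R) (N : nat) (N_gt0 : (0 < N)%N)
  (* the physical grid *)
  (xg : gridfun R N)
  (xg_first : xg ord0 = a) (xg_last : xg ord_max = b)
  (xg_incr : forall i : 'I_N, xg (lpt i) < xg (rpt i))
  (* the coordinate transformation and its Jacobian *)
  (x J : R -> R)
  (x_into : set_fun `[0, 1] `[a, b] x)
  (x_inj : set_inj `[0, 1] x)
  (x_at0 : x 0 = a) (x_at1 : x 1 = b)
  (x_grid : forall i : 'I_N.+1, x (xi R N i) = xg i)
  (x_deriv : forall s : R, s \in `[0, 1] ->
     has_derivative_within `[0, 1] x s (J s))
  (J_gt0 : forall s : R, s \in `[0, 1] -> 0 < J s) :
  exists Hhat : R -> R -> R,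
    [/\ monotone_flux Hhat, consistent_flux Hhat H &
    forall (dt : R) (phi : nat -> gridfun R N)
      (* left- and right-biased approximations of phi_xi, computed at time
         level n from the grid function phi n *)
      (Dm Dp : nat -> gridfun R N -> gridfun R N)
      (phixm phixp : nat -> gridfun R N),
      0 < dt ->
      (forall (n : nat) (i : 'I_N.+1),
         Dm n (phi n) i = J (xi R N i) * phixm n i) ->
      (forall (n : nat) (i : 'I_N.+1),
         Dp n (phi n) i = J (xi R N i) * phixp n i) ->
      (forall (n : nat) (i : 'I_N.+1),
         phi n.+1 i = phi n i -
           dt * local_lax_friedrichs (transformed H (J (xi R N i)))
                  (Dm n (phi n) i) (Dp n (phi n) i)) ->
      forall (n : nat) (i : 'I_N),
        (cell_slope xg (phi n.+1) i - cell_slope xg (phi n) i) / dt =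
        - (1 / spacing xg i) *
          (Hhat (phixm n (rpt i)) (phixp n (rpt i)) -
           Hhat (phixm n (lpt i)) (phixp n (lpt i)))].
Proof.
(* This flux does not involve the Jacobian, so one function serves all grid points and time
   levels. *)
exists (local_lax_friedrichs H); split.
- exact: local_lax_friedrichs_monotone.
- exact: local_lax_friedrichs_consistent.
move=> dt phi Dm Dp phixm phixp dt_gt0 DmE DpE phiS n i.
have dt_neq0 := lt0r_neq0 dt_gt0.
have spacing_neq0 : spacing xg i != 0 by rewrite lt0r_neq0 // subr_gt0.
have phi_step j : phi n.+1 j =
    phi n j - dt * local_lax_friedrichs H (phixm n j) (phixp n j).
  rewrite phiS DmE DpE local_lax_friedrichs_transformed //.
  exact/J_gt0/xi_in01.
(* Differencing the updates at the two ends of a cell telescopes into a flux difference. *)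
rewrite /cell_slope !phi_step.
by field; rewrite dt_neq0 spacing_neq0.
Qed.
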